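(* Assume the $abc$ conjecture. Let $n\ge 5$ be an odd integer with $n\equiv 1 \pmod 4$, and fix $\delta_0>0$. For integers $A>1$, $B>1$, let $\mathcal M_n(A,B)$ be the set of pairs $(a,b)\in\mathbb Z^2$ with $A\le |a|\le 2A$ and $B\le |b|\le 2B$ such that the trinomial $f(t)=t^n+at+b$ is irreducible over $\mathbb Q$ and its discriminant $D_f$ is squarefree. Then there is a constant $c>0$ (depending on $n$ and $\delta_0$) such that for all sufficiently large $A$ and all $B>A^{1+\delta_0}$, $$\#\mathcal M_n(A,B)\ge c\,AB.$$
   Context: The $abc$ conjecture: for every $\epsilon>0$ there is a constant $C_\epsilon$ such that whenever $a,b,c$ are coprime positive integers with $a+b=c$, one has $c\le C_\epsilon\, N(a,b,c)^{1+\epsilon}$, where $N(a,b,c)$ is the product of the distinct primes dividing $abc$. *)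

(* Defs.v *)
From HB Require Import structures.
From mathcomp Require Import all_boot all_order all_algebra.
From mathcomp Require Import boolp reals exp Rstruct.
Set Implicit Arguments. Unset Strict Implicit. Unset Printing Implicit Defensive.
Import Order.TTheory GRing.Theory Num.Theory.
Local Open Scope ring_scope.

Definition rad (x : nat) : nat := (\prod_(p <- primes x) p)%N.

Definition abc_conjecture : Prop :=
  forall eps : Rdefinitions.R, 0 < eps ->
  exists C : Rdefinitions.R,
    forall a b c : nat, (0 < a)%N -> (0 < b)%N -> coprime a b -> a + b = c ->
      (c%:R : Rdefinitions.R) <= C * powR (rad (a * b * c))%:R (1 + eps).

Definition trinom (n : nat) (a b : int) : {poly int} :=
  'X^n + a%:P * 'X + b%:P.

Definition disc_monic (f : {poly int}) : int :=
  (-1) ^+ ((size f).-1 * (size f).-2)./2 * resultant f f^`().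

(* squarefree integer: no square of a non-unit divides it (0 is not squarefree) *)
Definition squarefree_int (D : int) : Prop :=
  forall d : int, (d * d %| D)%Z -> `|d| = 1.

Definition inM (n A B : nat) (ab : int * int) : Prop :=
  let: (a, b) := ab in
  [/\ (A%:Z <= `|a|) && (`|a| <= (2 * A)%N%:Z),
      (B%:Z <= `|b|) && (`|b| <= (2 * B)%N%:Z),
      irreducible_poly (map_poly (intr : int -> rat) (trinom n a b))
    & squarefree_int (disc_monic (trinom n a b))].

Definition zrange (A : nat) : seq int :=
  [seq (x%:Z - (2 * A)%N%:Z) | x <- iota 0 (4 * A).+1].

Definition cardM (n A B : nat) : nat :=
  count (fun ab => `[< inM n A B ab >])
    [seq (a, b) | a <- zrange A, b <- zrange B].

(* Main.v *)
From HB Require Import structures.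
From mathcomp Require Import all_boot all_order all_algebra.
From mathcomp Require Import cyclic finfield cyclotomic.
From mathcomp Require Import boolp reals sequences exp Rstruct.
From mathcomp Require Import zify ring lra.
Require Import Defs.
Set Implicit Arguments. Unset Strict Implicit. Unset Printing Implicit Defensive.
Import Order.TTheory GRing.Theory Num.Theory.
Local Open Scope ring_scope.

(** Write [m = n - 1].  The discriminant of [t^n + a t + b] is
    [v + u] with [v = n^n b^m] and [u = m^m a^n]; as [n] is odd, replacing [a] by
    [- a] turns it into [v - u].  If [u], [v] are coprime, the abc conjecture for
    [u^2 + (v^2 - u^2) = v^2] bounds the squareful part of [(v + u)(v - u)] by about
    [a b], so [v + u] and [v - u] cannot both be divisible by squares of primes
    exceeding a constant times [B], because [A] is smaller than a power [B^(1-theta)].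
    Hence it suffices to find a positive proportion of pairs [(a, b)] for which
    neither value is divisible by [p^2] with [p] at most a small multiple of [B].
    Primes up to a constant [z] are excluded by congruences on [a] and [b]; for a
    larger [p] not dividing [a] at most [2 m] classes of [b] modulo [p^2] are bad,
    and a larger [p] dividing [a] must also divide [b].  One of the congruences
    also gives irreducibility: for a prime [l = 1 (mod n)] with [l | a] and [- b] a
    primitive root modulo [l], the polynomial is irreducible modulo [l]. *)

(** * Discriminant of a trinomial *)

Lemma eqn_neqF (x y : nat) : x <> y -> (x == y) = false.
Proof. by move=> /eqP/negbTE. Qed.

(** Entries are indexed by [nat], so one entry function serves determinants of every size without
    casts between ordinal types. *)
Definition det_fun (R : comNzRingType) (N : nat) (F : nat -> nat -> R) : R :=
  \det (\matrix_(i < N, j < N) F i j).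

Lemma det_fun_recr (R : comNzRingType) (N : nat) (F : nat -> nat -> R) :
  (forall i, (i < N)%N -> F i N = 0) ->
  det_fun N.+1 F = det_fun N F * F N N.
Proof.
move=> F0; rewrite /det_fun (expand_det_col _ ord_max) big_ord_recr /=.
rewrite big1 ?add0r => [|i _]; last by rewrite mxE /= F0 ?mul0r.
rewrite mxE mulrC /cofactor /= -signr_odd addnn odd_double expr0 mul1r.
by congr (\det _ * _); apply/matrixP=> i j; rewrite !mxE !lift_max.
Qed.

Lemma det_fun_ltrig (R : comNzRingType) (N : nat) (F : nat -> nat -> R) :
  (forall i j, (i < j < N)%N -> F i j = 0) ->
  det_fun N F = \prod_(i < N) F i i.
Proof.
move=> F0; rewrite /det_fun det_trig; first by apply: eq_bigr => i _; rewrite mxE.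
by apply/is_trig_mxP => i j ij; rewrite mxE F0 // ij ltn_ord.
Qed.

Lemma det_fun_utrig (R : comNzRingType) (N : nat) (F : nat -> nat -> R) :
  (forall i j, (j < i < N)%N -> F i j = 0) ->
  det_fun N F = \prod_(i < N) F i i.
Proof.
move=> F0; rewrite -(det_fun_ltrig (F := fun i j => F j i)) => [|i j]; last exact: F0.
by rewrite /det_fun -det_tr; congr (\det _); apply/matrixP => i j; rewrite !mxE.
Qed.

(* The rows are the coefficients of X^i (c X + d) for i < m, and of the last
   polynomial e X^m + a. *)
Lemma det_linear_shifts (R : comNzRingType) (m : nat) (c d e a : R) :
  det_fun m.+1 (fun i j => if (i < m)%N then c *+ (j == i.+1) + d *+ (j == i)
                           else e *+ (j == m) + a *+ (j == 0%N)) =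
  e * d ^+ m + a * (- c) ^+ m.
Proof.
(* The determinant is linear in its last row. [G s] has the unit vector at [s] there: [G m] is upper
   triangular, and expanding [G 0] along its last row leaves a lower triangular minor with diagonal
   [c]. *)
pose G (s i j : nat) : R :=
  if (i < m)%N then c *+ (j == i.+1) + d *+ (j == i) else (j == s)%:R.
have -> : e * d ^+ m + a * (- c) ^+ m
    = e * det_fun m.+1 (G m) + a * det_fun m.+1 (G 0%N).
  congr (_ * _ + _ * _).
    rewrite det_fun_utrig => [|i j /andP[ji im]].
      rewrite big_ord_recr /= /G ltnn eqxx mulr1 -[m in LHS]card_ord -prodr_const.
      apply: eq_bigr => i _; rewrite ltn_ord eqxx.
      by rewrite eqn_neqF ?add0r //; lia.
    rewrite /G; case: ifP => h.
      by rewrite !eqn_neqF ?addr0 //; lia.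
    by rewrite eqn_neqF //; lia.
  rewrite /det_fun (expand_det_row _ ord_max) big_ord_recl /=.
  rewrite [X in _ = _ + X]big1 ?addr0 => [|j _]; last first.
    by rewrite mxE /= /G ltnn /= mul0r.
  rewrite mxE /G /= ltnn ?mulr1n mul1r /cofactor /= addn0 (exprNn c);congr (_ * _).
  have := @det_fun_ltrig R m (fun i j => c *+ (j == i) + d *+ (j.+1 == i)).
  rewrite /det_fun => H; transitivity (\det (\matrix_(i < m, j < m)
      (c *+ (j == i :> nat) + d *+ (j.+1 == i)))); last first.
    by congr (\det _); apply/matrixP => i j; rewrite !mxE lift_max ltn_ord
      ?lift0 /= /bump /= ?add1n ?eqSS.
  rewrite H => [|i j /andP[ij jm]]; last first.
    by rewrite !eqn_neqF ?addr0 //; lia.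
  rewrite -[m in LHS]card_ord -prodr_const; apply: eq_bigr => i _.
  by rewrite eqxx eqn_neqF ?addr0 //; lia.
rewrite /det_fun; apply: (determinant_multilinear (i0 := ord_max)).
- by apply/rowP => j; rewrite !mxE /G /= ltnn !mulr_natr.
- by apply/matrixP => i j; rewrite !mxE /G lift_max ltn_ord.
- by apply/matrixP => i j; rewrite !mxE /G lift_max ltn_ord.
Qed.

Section TrinomialDiscriminant.
Variables (m : nat) (a b : int).
Hypothesis m_gt0 : (0 < m)%N.
Let n := m.+1.
Let p := trinom n a b.

Lemma coef_trinom k : p`_k = (k == n)%:R + a *+ (k == 1%N) + b *+ (k == 0%N).
Proof.
rewrite /p /trinom !coefD coefXn mul_polyC coefZ coefX coefC mulr_natr.
by congr (_ + _); case: k.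
Qed.

Lemma size_trinom : size p = n.+1.
Proof.
rewrite /p /trinom -addrA size_polyDl size_polyXn //.
have [s1 s2] := (size_polyMleq a%:P 'X, size_polyC_leq1 a).
apply: leq_ltn_trans (size_polyD _ _) _.
rewrite gtn_max mul_polyC; apply/andP; split.
  by apply: leq_ltn_trans (size_scale_leq _ _) _; rewrite size_polyX /n; lia.
by apply: leq_ltn_trans (size_polyC_leq1 _) _.
Qed.

Lemma trinom_monic : p \is monic.
Proof.
apply/monicP; rewrite /lead_coef size_trinom /= coef_trinom eqxx.
by rewrite !eqn_neqF ?addr0 /n //; lia.
Qed.

Lemma coef_deriv_trinom k : (p^`())`_k = n%:R *+ (k == m) + a *+ (k == 0%N).
Proof.
rewrite coef_deriv coef_trinom !mulrnDl eqSS eqSS mul0rn addr0.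
congr (_ + _); last by case: eqP => [->|]; rewrite ?mul0rn.
by case: eqP => [->|]; rewrite ?mul0rn.
Qed.

Lemma size_deriv_trinom : size p^`() = n.
Proof.
apply: anti_leq; apply/andP; split.
  by rewrite -ltnS -size_trinom lt_size_deriv // -size_poly_gt0 size_trinom.
rewrite ltnNge; apply/negP => /leq_sizeP/(_ m (leqnn m)).
by rewrite coef_deriv_trinom eqxx eqn_neqF ?addr0; lia.
Qed.

(* The elimination is [n X^k p - X^(k+1) p' = X^k (m a X + n b)]. *)
Lemma resultant_trinom : ~~ odd m ->
  resultant p p^`() = n%:R ^+ n * b ^+ m + m%:R ^+ m * a ^+ n.
Proof.
move=> m_even; have nE : n = m.+1 by [].
pose S (i j : nat) : int := if (i < m)%N then
    (j == i + n)%N%:R + a *+ (j == i.+1) + b *+ (j == i)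
  else n%:R *+ (j == i) + a *+ (j + m == i)%N.
pose T (i j : nat) : int := if (i < m)%N then
    (m%:R * a) *+ (j == i.+1) + (n%:R * b) *+ (j == i)
  else n%:R *+ (j == i) + a *+ (j + m == i)%N.
(* Left multiplication by [L] carries out the elimination on the Sylvester matrix [S]: row
   [m + i + 1] holds [X^(i+1) p'], and [T] is the result. *)
pose L (i k : nat) : int := if (i < m)%N then
    n%:R *+ (k == i) - (k == (m + i).+1)%N%:R else (k == i)%:R.
have resE : resultant p p^`() = det_fun (m + n)%N S.
  rewrite /resultant /det_fun; set M := Sylvester_mx _ _.
  have ME i j : M i j = S i j.
    rewrite Sylvester_mxE; case: splitP => k ik.
      rewrite /S ik.
      have := ltn_ord k; rewrite {2}size_deriv_trinom /= => km; rewrite km.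
      rewrite coef_trinom; case: leqP => kj; last first.
        by rewrite mulr0n !eqn_neqF ?addr0 //; lia.
      by rewrite mulr1n; congr (_%:R + _ *+ _ + _ *+ _); lia.
    have := ltn_ord k; rewrite {2}size_trinom /= => kn.
    have {}ik : i = (m + k)%N :> nat by rewrite ik size_deriv_trinom.
    rewrite coef_deriv_trinom /S ik ltnNge leq_addr /=.
    case: leqP => kj; last first.
      by rewrite mulr0n !eqn_neqF ?addr0 //; lia.
    by rewrite mulr1n; congr (_ *+ _ + _ *+ _); lia.
  have -> : \det M = det_fun ((size p^`()).-1 + (size p).-1) S.
    by rewrite /det_fun; congr (\det _); apply/matrixP => i j; rewrite [RHS]mxE ME.
  by rewrite size_trinom size_deriv_trinom.
have LS : det_fun (m + n)%N L * det_fun (m + n)%N S = det_fun (m + n)%N T.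
  rewrite /det_fun -det_mulmx; congr (\det _); apply/matrixP => i j.
  rewrite !mxE; case: (ltnP i m) => im; last first.
    rewrite (bigD1 i) //= big1 => [|k].
      by rewrite !mxE /L ltnNge im /= eqxx mul1r addr0 /S /T ltnNge im.
    rewrite -(inj_eq val_inj) /= => ki.
    by rewrite !mxE /L ltnNge im /= eqn_neqF ?mul0r //; lia.
  have i'lt : ((m + i).+1 < m + n)%N. by lia.
  rewrite (bigD1 i) //= (bigD1 (Ordinal i'lt)) /=; last by apply/eqP => /(congr1 val) /=; lia.
  rewrite big1 => [|k /andP[ki ki']].
    rewrite !mxE /L im /= !eqxx !eqn_neqF; try lia.
    rewrite mulr0n sub0r subr0 addr0 mulr1n /S /T im /= ifN; last by lia.
    rewrite (_ : (j + m == _)%N = (j == i.+1 :> nat)); last by lia.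
    rewrite (_ : (j == (m + i).+1 :> nat) = (j == i + n :> nat)%N); last by lia.
    by do 3![case: eqP => _]; rewrite /= /n; ring.
  rewrite !mxE /L im !eqn_neqF ?subrr ?mul0r //.
    by move=> h; case/eqP: ki'; apply: val_inj.
  by move=> h; case/eqP: ki; apply: val_inj.
have detL : det_fun (m + n)%N L = n%:R ^+ m.
  rewrite det_fun_utrig => [|i j /andP[ji im]]; last first.
    by rewrite /L; case: ifP => h; rewrite !eqn_neqF ?subrr //; lia.
  rewrite big_split_ord /= [X in _ * X]big1 => [|i _]; last first.
    by rewrite /L ltnNge leq_addr /= eqxx.
  rewrite mulr1 -[m in RHS]card_ord -prodr_const; apply: eq_bigr => i _.
  by rewrite /L ltn_ord eqxx eqn_neqF ?subr0 //; lia.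
(* Beyond column [m], each column of [T] is zero above its diagonal entry [n]. Peeling these columns
   off gives the factor [n^m], which cancels [det L]. *)
have detT k : (k <= m)%N -> det_fun (m + k.+1)%N T = det_fun m.+1 T * n%:R ^+ k.
  elim: k => [|k IHk] km; first by rewrite mulr1 addn1.
  rewrite addnS det_fun_recr => [|i im]; last first.
    by rewrite /T; case: ifP => h; rewrite !eqn_neqF ?addr0 //; lia.
  rewrite IHk 1?ltnW // exprSr mulrA; congr (_ * _).
  rewrite /T ifN; last by lia.
  by rewrite eqxx eqn_neqF ?addr0 //; lia.
have detT0 : det_fun m.+1 T = n%:R * (n%:R * b) ^+ m + a * (- (m%:R * a)) ^+ m.
  rewrite -det_linear_shifts /det_fun; congr (\det _); apply/matrixP => i j.
  rewrite !mxE /T; case: ifP => // im.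
  by congr (_ *+ _ + _ *+ _); have := ltn_ord i; lia.
have n0 : (n%:R : int) ^+ m != 0 by rewrite expf_neq0 // pnatr_eq0.
apply: (mulfI n0); rewrite resE -detL LS (detT m) // detL mulrC; congr (_ * _).
rewrite detT0 exprNn -signr_odd (negbTE m_even) expr0 mul1r !exprMn.
by rewrite /n !exprS; ring.
Qed.

(** The sign exponent [n m / 2] is even when [4 %| m], so the discriminant is the resultant
    itself. *)
Lemma disc_trinom : (4 %| m)%N ->
  disc_monic p = n%:R ^+ n * b ^+ m + m%:R ^+ m * a ^+ n.
Proof.
move=> /dvdnP[k mk]; rewrite /disc_monic size_trinom /= resultant_trinom; last by lia.
by rewrite -signr_odd (_ : odd _ = false) ?mul1r // /n; lia.
Qed.
End TrinomialDiscriminant.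

(** * Primes congruent to 1 modulo n *)

Lemma Cyclotomic_horner0_unit (n : nat) : (0 < n)%N -> `|('Phi_n).[0]|%N = 1%N.
Proof.
move=> n_gt0.
have /(congr1 (fun p : {poly int} => `|p.[0]|%N)) := prod_Cyclotomic n_gt0.
rewrite (big_rem n) /=; last by rewrite -dvdn_divisors.
rewrite !hornerE expr0n (gtn_eqF n_gt0) sub0r abszM => /eqP.
by rewrite muln_eq1 => /andP[/eqP].
Qed.

(** A root [y] of the [n]-th cyclotomic polynomial modulo [p] has order exactly [n], which divides
    [p - 1] by Fermat. A smaller order would make [y] a root of a second cyclotomic factor, hence a
    double root of [X^n - 1]; but the derivative [n X^(n-1)] does not vanish at [y]. *)
Lemma prime_dvd_Cyclotomic_mod (n p : nat) (x : int) :
    (0 < n)%N -> prime p -> ~~ (p %| n)%N -> (p %| ('Phi_n).[x])%Z ->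
  (n %| p.-1)%N.
Proof.
move=> n_gt0 p_pr pn px.
have chF := pchar_Fp p_pr.
pose y : 'F_p := x%:~R.
pose P e : {poly 'F_p} := map_poly intr 'Phi_e.
have prodP k : (0 < k)%N -> \prod_(e <- divisors k) P e = 'X^k - 1.
  move=> k_gt0; rewrite -rmorph_prod prod_Cyclotomic // rmorphB /= rmorph1.
  by rewrite map_polyXn.
have Pn0 : (P n).[y] = 0.
  by rewrite horner_map /=; apply/eqP; rewrite -(dvdz_pcharf chF).
have defXn : 'X^n - 1 = P n * \prod_(e <- rem n (divisors n)) P e.
  by rewrite -prodP // (big_rem n) // -dvdn_divisors.
have yn : y ^+ n = 1.
  have /(congr1 (fun p : {poly _} => p.[y])) := defXn.
  by rewrite hornerM Pn0 mul0r !hornerE => /eqP; rewrite subr_eq0 => /eqP.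
have y0 : y != 0.
  by apply: contra_eq_neq yn => ->; rewrite expr0n (gtn_eqF n_gt0) eq_sym oner_eq0.
have [d prim_d dn] := prim_order_exists n_gt0 yn.
have [E|dn'] := eqVneq d n.
  rewrite -E (prim_order_dvd prim_d); apply/eqP.
  have := expf_card y; rewrite card_Fp // => Fermat.
  by apply: (mulfI y0); rewrite -exprS prednK ?prime_gt0 // mulr1.
exfalso; have d_gt0 := prim_order_gt0 prim_d.
have [e ed e0] : exists2 e, (e %| d)%N & (P e).[y] = 0.
  have /(congr1 (fun p : {poly _} => p.[y])) := prodP d d_gt0.
  rewrite hornerD hornerN hornerXn hornerC (prim_expr_order prim_d) subrr.
  rewrite horner_prod => /eqP; rewrite prodf_seq_eq0 => /hasP[e].
  by rewrite -dvdn_divisors // => ed /= /eqP; exists e.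
have e_rem : e \in rem n (divisors n).
  rewrite mem_rem_uniq ?divisors_uniq // inE -dvdn_divisors // (dvdn_trans ed dn).
  rewrite andbT; apply: contraNneq dn' => En.
  by apply/eqP/anti_leq; rewrite dvdn_leq // -En dvdn_leq.
have /(congr1 (fun p : {poly _} => p^`().[y])) := defXn.
rewrite derivM hornerD !hornerM Pn0 mul0r addr0 (big_rem e) //= hornerM e0 mul0r mulr0.
rewrite derivB derivXn derivC subr0 hornerMn hornerXn => /eqP.
rewrite -mulr_natr mulf_eq0 expf_eq0 (negbTE y0) andbF /= -(dvdn_pcharf chF).
by rewrite (negbTE pn).
Qed.

(** The polynomial [q] has finitely many roots, so the cyclotomic value at some multiple [n k] is
    none of 0, 1, -1 and has a prime factor [p]. If [p] divided [n], that value would be congruent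
    modulo [p] to the value at 0, a unit. *)
Lemma exists_prime_1mod (n : nat) : (1 < n)%N ->
  exists2 p, prime p & (n %| p.-1)%N.
Proof.
move=> n_gt1; have n_gt0 := ltnW n_gt1.
pose q := 'Phi_n * ('Phi_n ^+ 2 - 1).
have sPhi : (1 < size 'Phi_n)%N by rewrite size_Cyclotomic ltnS totient_gt0.
have q0 : q != 0.
  apply: mulf_neq0; first by rewrite monic_neq0 ?Cyclotomic_monic.
  rewrite subr_eq0.
  apply: contraTneq sPhi => E.
  by have := size_exp 'Phi_n 2; rewrite E size_poly1; case: (size _) => [|[|k]].
have [k kq] : exists k : nat, ~~ root q (n * k)%N%:Z.
  apply: contrapT => H.
  have {}H k : root q (n * k)%N%:Z.
    by apply: contrapT => /negP h; apply: H; exists k.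
  pose s := [seq (n * k)%N%:Z | k <- iota 0 (size q)].
  suff : (size s < size q)%N by rewrite size_map size_iota ltnn.
  apply: max_poly_roots => //.
    by apply/allP => _ /mapP[k _ ->].
  by rewrite map_inj_uniq ?iota_uniq // => x y [] /eqP; rewrite eqn_pmul2l // => /eqP.
move: kq; rewrite /root hornerM mulf_eq0 negb_or => /andP[Phi0 Phi1].
have [|p p_pr pPhi] := @pdivP `|('Phi_n).[(n * k)%N%:Z]|%N.
  rewrite ltn_neqAle eq_sym absz_gt0 Phi0 andbT.
  apply: contraNneq Phi1; rewrite hornerD hornerN hornerC horner_exp.
  by rewrite subr_eq0 sqrf_eq1; move: ('Phi_n).[_] => x; lia.
exists p => //; apply: (prime_dvd_Cyclotomic_mod (x := (n * k)%N%:Z)) => //.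
apply: contraL pPhi => pn.
have chF := pchar_Fp p_pr.
have pE (x : int) : (p %| `|x|)%N = (x%:~R == 0 :> 'F_p).
  by rewrite -(dvdz_pcharf chF) dvdzE.
suff -> : (p %| `|('Phi_n).[(n * k)%N%:Z]|)%N = (p %| `|('Phi_n).[0]|)%N.
  by rewrite Cyclotomic_horner0_unit // dvdn1 gtn_eqF ?prime_gt1.
rewrite !pE -!horner_map /=; congr (_.[_] == 0).
by apply/eqP; rewrite -pE /= dvdn_mulr.
Qed.

(** * Irreducibility *)

(** By Cayley-Hamilton the companion matrix [C] of [h] satisfies [C^n = c I]; the determinant of
    both sides gives the equation with [x = det C]. *)
Lemma companion_dvd_XnsubC (F : fieldType) (n : nat) (c : F) (h : {poly F}) :
  (0 < n)%N -> h \is monic -> (1 < size h)%N -> h %| 'X^n - c%:P ->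
  exists x : F, x ^+ n = c ^+ (size h).-1.
Proof.
move=> n_gt0 h_mon h_gt1 h_dvd; exists (\det (companionmx h)).
have := companionmxK h_mon; move: (companionmx h).
case E : (size h).-1 => [|d] C CE; first by lia.
have : horner_mx C ('X^n - c%:P) = 0.
  case/dvdpP: h_dvd => k ->; rewrite rmorphM /= -[X in _ * horner_mx _ X]CE.
  by rewrite Cayley_Hamilton mulr0.
rewrite rmorphB /= rmorphXn /= horner_mx_X horner_mx_C => /eqP.
rewrite subr_eq0 => /eqP CnE.
have detX k : \det (C ^+ k) = \det C ^+ k.
  by elim: k => [|k IHk]; rewrite ?expr0 ?det1 // !exprS -IHk det_mulmx.
by rewrite -detX CnE det_scalar.
Qed.

(** By the companion matrix argument, [n] divides the degree of every nonconstant factor, so such a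
    factor has full degree. *)
Lemma irreducible_XnsubC (F : fieldType) (n : nat) (c : F) : (0 < n)%N ->
  (forall (x : F) d, x ^+ n = c ^+ d -> (n %| d)%N) ->
  irreducible_poly ('X^n - c%:P).
Proof.
move=> n_gt0 c_gen; split=> [|h h1 h_dvd]; first by rewrite size_XnsubC.
have X0 : 'X^n - c%:P != 0 by rewrite monic_neq0 ?monicXnsubC.
have h0 : h != 0 by apply: contraNneq X0 => h0; rewrite h0 dvd0p in h_dvd.
have lh0 : (lead_coef h)^-1 != 0 by rewrite invr_eq0 lead_coef_eq0.
have h_gt1 : (1 < size h)%N by rewrite ltn_neqAle eq_sym h1 size_poly_gt0.
have [||| x xn] := @companion_dvd_XnsubC F n c ((lead_coef h)^-1 *: h) n_gt0.
- by rewrite monicE lead_coefZ mulVf // lead_coef_eq0.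
- by rewrite size_scale.
- by rewrite dvdpZl.
rewrite -dvdp_size_eqp // eqn_leq dvdp_leq //= size_XnsubC //; move: (c_gen _ _ xn); rewrite size_scale // => /dvdn_leq.
by move: h_gt1; case: (size h) => [|[|k]] // _; apply.
Qed.

(** By Gauss's lemma a rational factor rescales to an integral one. As [f] is monic, the leading
    coefficients of the integral factors are units, so reduction modulo [p] preserves degrees. *)
Lemma irreducible_map_Fp (p : nat) (f : {poly int}) : prime p -> f \is monic ->
  irreducible_poly (map_poly (intr : int -> 'F_p) f) ->
  irreducible_poly (map_poly (intr : int -> rat) f).
Proof.
move=> p_pr f_mon [sf f_irr].
have szF (g : {poly int}) : lead_coef g \is a GRing.unit ->
    size (map_poly (intr : int -> 'F_p) g) = size g.
  move=> ug; apply: size_map_poly_id0.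
  have := rmorph_unit (intr : {rmorphism int -> 'F_p}) ug.
  by rewrite unitfE.
have uf : lead_coef f \is a GRing.unit by rewrite (monicP f_mon) unitr1.
split; first by rewrite size_rat_int_poly -szF.
move=> q sq /dvdpP_rat_int[g [c c0 qE]] [h fE]; move: sq; rewrite {q}qE.
rewrite size_scale // size_rat_int_poly => sg1.
have : lead_coef g * lead_coef h \is a GRing.unit by rewrite -lead_coefM -fE.
rewrite unitrM => /andP[ug uh].
have := f_irr (map_poly intr g); rewrite szF // => /(_ sg1).
rewrite {1}fE rmorphM /= dvdp_mulIl => /(_ isT) /eqp_size.
rewrite !szF // => sgf.
rewrite (eqp_trans (eqp_scale _ c0)) //.
rewrite -dvdp_size_eqp; first by rewrite !size_rat_int_poly sgf.
by rewrite fE rmorphM /= dvdp_mulIl.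
Qed.

(** Take [g] a primitive root. If [g^d] is the [n]-th power of [g^i], then [d] and [i n] agree
    modulo [p - 1], hence modulo [n]. *)
Lemma Fp_power_free (p n : nat) : prime p -> (0 < n)%N -> (n %| p.-1)%N ->
  exists2 g : 'F_p, g != 0 &
    forall (x : 'F_p) d, x ^+ n = g ^+ d -> (n %| d)%N.
Proof.
move=> p_pr n_gt0 np.
have p1 : (0 < p.-1)%N by have := prime_gt1 p_pr; lia.
have /hasP[g + prim_g] : has p.-1.-primitive_root [seq x <- enum 'F_p | x != 0].
  apply: has_prim_root => //.
  - apply/allP => x; rewrite mem_filter => /andP[x0 _]; rewrite unity_rootE.
    apply/eqP/(mulfI x0); rewrite -exprS prednK ?prime_gt0 // mulr1.
    by have := expf_card x; rewrite card_Fp.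
  - by rewrite filter_uniq ?enum_uniq.
  - have E := count_predC (pred1 (0 : 'F_p)) (enum 'F_p).
    rewrite -cardE card_Fp // in E.
    have E0 : (count (pred1 (0%R : 'F_p)) (enum 'F_p) <= 1)%N.
      by rewrite count_uniq_mem ?enum_uniq ?leq_b1.
    have -> : size [seq x <- enum 'F_p | x != 0] = count (predC (pred1 0)) (enum 'F_p).
      by rewrite size_filter; apply: eq_count.
    by move: E E0; move: (count (pred1 _) _) (count (predC _) _) => u v; lia.
rewrite mem_filter => /andP[g0 _].
exists g => // x d xd.
have x0 : x != 0.
  by apply: contraTneq (expf_neq0 d g0) => x0; rewrite -xd x0 expr0n (gtn_eqF n_gt0) eqxx.
have : x ^+ p.-1 = 1.
  apply: (mulfI x0); rewrite -exprS prednK ?prime_gt0 // mulr1.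
  by have := expf_card x; rewrite card_Fp.
case/(prim_rootP prim_g) => i xE.
move/eqP: xd; rewrite xE -exprM (eq_prim_root_expr prim_g) => /eqP.
move=> /(congr1 (modn^~ n)); rewrite !modn_dvdm // modnMl => /esym/eqP.
by [].
Qed.

(** * Sieving by squares of primes *)

Definition trinom_disc (m : nat) (a b : int) : int :=
  m.+1%:R ^+ m.+1 * b ^+ m + m%:R ^+ m * a ^+ m.+1.

(** Cut the range into blocks of length [d]. Within a block the colour determines [j], so a block
    contains at most [c] hits. *)
Lemma sum_pred_blocks (N d c : nat) (T : finType) (C : {set T}) (col : nat -> T)
    (P : pred nat) : (#|C| <= c)%N ->
    (forall j, P j -> col j \in C) ->
    (forall j j', P j -> P j' -> (j %/ d = j' %/ d)%N -> col j = col j' -> j = j') ->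
  (\sum_(j < N) P j <= c * (N %/ d).+1)%N.
Proof.
move=> Cc colC inj.
have -> : (\sum_(j < N) P j = #|[set j : 'I_N | P j]|)%N.
  rewrite -sum1_card [RHS]big_mkcond /=.
  by apply: eq_bigr => j _; rewrite inE; case: (P j).
pose f (j : 'I_N) := (inord (j %/ d) : 'I_(N %/ d).+1, col j).
rewrite -(card_in_imset (f := f)); last first.
  move=> i j; rewrite !inE => Pi Pj [] /(congr1 val).
  by rewrite /= !inordK ?ltnS ?leq_div2r 1?ltnW // => Ed Ec; apply/val_inj/inj.
have sub : f @: [set j : 'I_N | P j] \subset setX setT C.
  by apply/subsetP => _ /imsetP[j + ->]; rewrite !inE /= => /colC.
apply: leq_trans (subset_leq_card sub) _.
by rewrite cardsX cardsT card_ord mulnC leq_mul2r Cc orbT.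
Qed.

Lemma sum_dvd_progression (N d x0 Q : nat) : coprime d Q ->
  (\sum_(j < N) (d %| x0 + Q * j) <= (N %/ d).+1)%N.
Proof.
move=> dQ; rewrite -[leqRHS]mul1n.
apply: (@sum_pred_blocks N d 1 _ [set: 'I_1] (fun=> ord0) (fun j => d %| x0 + Q * j)%N).
- by rewrite cardsT card_ord.
- by move=> j; rewrite inE.
move=> j j' dj dj' E _; wlog le_jj : j j' dj dj' E / (j <= j')%N.
  by move=> H; case: (leqP j j') => h; [exact: H | apply/esym/H => //; exact: ltnW].
have : (d %| (x0 + Q * j') - (x0 + Q * j))%N by rewrite dvdn_sub.
rewrite subnDl -mulnBr Gauss_dvdr // -eqn_mod_dvd // => /eqP Em.
by rewrite (divn_eq j d) (divn_eq j' d) E Em.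
Qed.

Lemma card_nth_roots (F : finFieldType) (m : nat) (c : F) : (0 < m)%N ->
  (#|[set x : F | x ^+ m == c]| <= m)%N.
Proof.
move=> m_gt0; rewrite cardE -ltnS -(size_XnsubC c m_gt0).
apply: max_poly_roots; first by rewrite monic_neq0 ?monicXnsubC.
  apply/allP => x; rewrite mem_enum inE => /eqP xm.
  by rewrite /root !hornerE xm subrr.
exact: enum_uniq.
Qed.

Lemma dvdz_Fp (p : nat) (x : int) : prime p -> (p %| x)%Z = (x%:~R == 0 :> 'F_p).
Proof. by move=> p_pr; rewrite (dvdz_pcharf (pchar_Fp p_pr)). Qed.

Lemma natr_Fp_neq0 (p k : nat) : prime p -> (0 < k < p)%N -> (k%:R : 'F_p) != 0.
Proof.
move=> p_pr kp; rewrite -(dvdn_pcharf (pchar_Fp p_pr)) gtnNdvd //.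
all: by lia.
Qed.

Lemma trinom_disc_Fp (p m : nat) (a b : int) :
  (trinom_disc m a b)%:~R =
  m.+1%:R ^+ m.+1 * b%:~R ^+ m + m%:R ^+ m * a%:~R ^+ m.+1 :> 'F_p.
Proof. by rewrite /trinom_disc rmorphD !rmorphM !rmorphXn /= !rmorph_nat. Qed.

(** Colour [b] by its residue modulo [p], one of at most [m] roots of [x^m = c]. These roots are
    simple: if [b] and [b'] share a residue, then [b^m - b'^m] is [b - b'] times a factor congruent
    to [m b^(m-1)], a unit, so the residue fixes [b] modulo [p^2]. *)
Lemma sum_sq_dvd_trinom_disc (p m Y Q b1 : nat) (a : int) :
    prime p -> (0 < m)%N -> (m.+1 < p)%N -> coprime p Q -> ~~ (p %| a)%Z ->
  (\sum_(j < Y) ((p ^ 2)%N %| trinom_disc m a (b1 + Q * j)%N%:Z)%Z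
     <= m * (Y %/ p ^ 2).+1)%N.
Proof.
move=> p_pr m_gt0 mp pQ pa.
pose c : 'F_p := - (m%:R ^+ m * a%:~R ^+ m.+1) / m.+1%:R ^+ m.+1.
have m0 : (m%:R : 'F_p) != 0 by rewrite natr_Fp_neq0 // m_gt0 ltnW.
have n0 : (m.+1%:R : 'F_p) != 0 by rewrite natr_Fp_neq0.
have a0 : (a%:~R : 'F_p) != 0 by rewrite -dvdz_Fp.
have root_c b : ((p ^ 2)%N %| trinom_disc m a b)%Z -> (b%:~R : 'F_p) ^+ m = c.
  move=> H; have : (p %| trinom_disc m a b)%Z.
    by apply: dvdz_trans H; rewrite dvdzE /= expnS dvdn_mulr.
  rewrite dvdz_Fp // trinom_disc_Fp addr_eq0 => /eqP E.
  apply: (mulfI (expf_neq0 m.+1 n0)); rewrite E /c.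
  by rewrite mulrCA divff ?mulr1 // expf_neq0.
have c0 : c != 0 by rewrite mulf_neq0 ?oppr_eq0 ?mulf_neq0 ?invr_eq0 ?expf_neq0.
apply: (@sum_pred_blocks Y (p ^ 2) m _ [set x : 'F_p | x ^+ m == c]
  (fun j => (b1 + Q * j)%N%:R)
  (fun j => (p ^ 2)%N %| trinom_disc m a (b1 + Q * j)%N%:Z)%Z).
- exact: card_nth_roots.
- by move=> j /root_c; rewrite inE => ->.
move=> j j' Dj Dj' Ed Ec.
have : ((p ^ 2)%N %| (b1 + Q * j)%N%:Z - (b1 + Q * j')%N%:Z)%Z.
  have b0 : ((b1 + Q * j)%N%:R : 'F_p) != 0.
    have Er : ((b1 + Q * j)%N%:R : 'F_p) ^+ m = c := root_c _ Dj.
    by apply: contra_eq_neq Er => ->; rewrite expr0n gtn_eqF // eq_sym.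
  move: Ec b0 Dj Dj'; set b := (b1 + Q * j)%N; set b' := (b1 + Q * j')%N.
  move=> Ec b0 Dj Dj'.
  have : ((p ^ 2)%N %| m.+1%:R ^+ m.+1 * (b%:Z ^+ m - b'%:Z ^+ m))%Z.
    have -> : m.+1%:R ^+ m.+1 * (b%:Z ^+ m - b'%:Z ^+ m)
       = trinom_disc m a b - trinom_disc m a b' by rewrite /trinom_disc; ring.
    by rewrite rpredB.
  have cop (x : int) : (x%:~R : 'F_p) != 0 -> coprimez (p ^ 2)%N x.
    by rewrite -dvdz_Fp // dvdzE -prime_coprime //= coprimezE /= => /(coprimeXl 2).
  rewrite Gauss_dvdzr; last by apply: cop; rewrite rmorphXn /= rmorph_nat expf_neq0.
  rewrite subrXX Gauss_dvdzl //; apply: cop.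
  rewrite rmorph_sum /=.
  under eq_bigr => i _ do rewrite rmorphM !rmorphXn /= -![_%:~R]/(_%:R) -Ec -exprD.
  rewrite (eq_bigr (fun=> b%:R ^+ m.-1)) => [|i _]; last first.
    by rewrite subnK // -ltnS prednK.
  by rewrite sumr_const card_ord -[_ *+ m]mulr_natr mulf_neq0 ?expf_neq0.
rewrite !PoszD opprD addrACA subrr add0r !PoszM -mulrBr.
rewrite Gauss_dvdzr; last by rewrite coprimezE; exact: (coprimeXl 2 pQ).
move=> jj'; suff Em : (j %% p ^ 2 = j' %% p ^ 2)%N.
  by rewrite (divn_eq j (p ^ 2)) (divn_eq j' (p ^ 2)) Ed Em.
apply/eqP; rewrite -eqz_nat; move: jj'; rewrite -eqz_mod_dvd.
by rewrite !modz_nat.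
Qed.

Lemma leq_term_sum_nat (F : nat -> nat) (u v p : nat) : (u <= p < v)%N ->
  (F p <= \sum_(u <= i < v) F i)%N.
Proof.
by move=> uv; rewrite (bigD1_seq p) ?mem_index_iota ?iota_uniq //= leq_addr.
Qed.

(** Both signs of [a] are sieved together, because the abc argument only shows that one of the two
    signs succeeds. *)
Definition disc_sq (m p a b : nat) : bool :=
  ((p ^ 2)%N %| trinom_disc m a%:Z b%:Z)%Z ||
  ((p ^ 2)%N %| trinom_disc m (- a%:Z) b%:Z)%Z.

Lemma disc_sq_dvdn (m p a b : nat) : prime p -> (0 < m)%N -> (m.+1 < p)%N ->
  disc_sq m p a b -> (p %| a)%N -> (p %| b)%N.
Proof.
move=> p_pr m_gt0 mp dsq pa.
have n0 : (m.+1%:R : 'F_p) != 0 by rewrite natr_Fp_neq0.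
have aux s : (s%:~R : 'F_p) = 0 -> ((p ^ 2)%N %| trinom_disc m s b%:Z)%Z -> (p %| b)%N.
  move=> s0 H; have : (p %| trinom_disc m s b)%Z.
    by apply: dvdz_trans H; rewrite dvdzE /= expnS dvdn_mulr.
  rewrite dvdz_Fp // trinom_disc_Fp s0 expr0n /= mulr0 addr0 mulf_eq0 expf_eq0.
  by rewrite (negbTE n0) andbF /= expf_eq0 m_gt0 /= -dvdz_Fp.
have a0 : (a%:Z%:~R : 'F_p) = 0 by apply/eqP; rewrite -dvdz_Fp.
by case/orP: dsq; apply: aux; rewrite ?rmorphN /= a0 ?oppr0.
Qed.

(** A union bound over [p > z]. In [F] the prime does not divide [a], and each sign allows at most
    [m] classes of [b], whence [2 m]. In [G] it divides [a], hence also [b], and [p <= a <= W]. *)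
Lemma sum_disc_sq (m z Q X Y a1 b1 Z W : nat) : (0 < m)%N -> (m < z)%N ->
    (forall p, prime p -> (z < p)%N -> coprime p Q) ->
    (forall i j p, prime p -> (p <= z)%N ->
       ~~ disc_sq m p (a1 + Q * i) (b1 + Q * j)) ->
    (forall i, (i < X)%N -> (0 < a1 + Q * i <= W)%N) ->
  (\sum_(i < X) \sum_(j < Y) [exists p : 'I_Z.+1,
      prime p && disc_sq m p (a1 + Q * i) (b1 + Q * j)]
   <= \sum_(z.+1 <= p < Z.+1) X * (m.*2 * (Y %/ p ^ 2).+1)
      + \sum_(z.+1 <= p < W.+1) (X %/ p).+1 * (Y %/ p).+1)%N.
Proof.
move=> m_gt0 mz zQ small aW.
pose a i := (a1 + Q * i)%N; pose b j := (b1 + Q * j)%N.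
pose F (p i j : nat) : nat := ((prime p && ~~ (p %| a i)) *
  (((p ^ 2)%N %| trinom_disc m (a i)%:Z (b j)%:Z)%Z +
  ((p ^ 2)%N %| trinom_disc m (- (a i)%:Z)%R (b j)%:Z)%Z))%N.
pose G (p i j : nat) : nat := (prime p * ((p %| a i) * (p %| b j)))%N.
have bound (i : 'I_X) (j : 'I_Y) :
    ([exists p : 'I_Z.+1, prime p && disc_sq m p (a i) (b j)] <=
    \sum_(z.+1 <= p < Z.+1) F p i j + \sum_(z.+1 <= p < W.+1) G p i j)%N.
  case: existsP => // -[[p pZ] /= /andP[p_pr dsq]].
  have zp : (z < p)%N by rewrite ltnNge; apply: contraL dsq => /(small i j _ p_pr).
  case pa : (p %| a i)%N.
    have pb := disc_sq_dvdn p_pr m_gt0 (leq_ltn_trans mz zp) dsq pa.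
    apply: leq_trans (leq_addl _ _).
    apply: leq_trans (@leq_term_sum_nat (fun p => G p i j) z.+1 W.+1 p _).
      by rewrite /G p_pr pa pb.
    have /andP[ai0 aiW] := aW i (ltn_ord i).
    by rewrite zp ltnS (leq_trans (dvdn_leq _ pa) aiW).
  apply: leq_trans (leq_addr _ _).
  apply: leq_trans (@leq_term_sum_nat (fun p => F p i j) z.+1 Z.+1 p _); last first.
    by rewrite zp.
  by rewrite /F p_pr pa mul1n; case/orP: dsq => ->; rewrite ?leq_addr ?leq_addl.
apply: (@leq_trans (\sum_(i < X) \sum_(j < Y)
  (\sum_(z.+1 <= p < Z.+1) F p i j + \sum_(z.+1 <= p < W.+1) G p i j))%N).
  by apply: leq_sum => i _; apply: leq_sum => j _; exact: bound.
rewrite (eq_bigr (fun i : 'I_X => \sum_(j < Y) \sum_(z.+1 <= p < Z.+1) F p i j +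
  \sum_(j < Y) \sum_(z.+1 <= p < W.+1) G p i j)%N) => [|i _]; last by rewrite big_split.
rewrite big_split /=; apply: leq_add.
  have -> : (\sum_(z.+1 <= p < Z.+1) X * (m.*2 * (Y %/ p ^ 2).+1)
     = \sum_(i < X) \sum_(z.+1 <= p < Z.+1) (m.*2 * (Y %/ p ^ 2).+1))%N.
    by rewrite sum_nat_const card_ord big_distrr.
  apply: leq_sum => i _; rewrite exchange_big /=.
  rewrite big_nat [leqRHS]big_nat; apply: leq_sum => p /andP[zp _].
  rewrite /F -big_distrr /= big_split /=.
  case: (boolP (prime p)) => //= p_pr; case: (boolP (p %| a i)%N) => //= pa.
  rewrite mul1n -addnn mulnDl; apply: leq_add; apply: sum_sq_dvd_trinom_disc => //;
    rewrite ?(leq_ltn_trans mz zp) ?zQ // dvdzE ?abszN //.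
under eq_bigr => i _ do rewrite exchange_big /=.
rewrite exchange_big /= big_nat [leqRHS]big_nat; apply: leq_sum => p /andP[zp _].
rewrite /G; case: (boolP (prime p)) => //= p_pr; last first.
  by rewrite big1 // => i _; rewrite big1.
under eq_bigr => i _ do (under eq_bigr => j _ do rewrite mul1n; rewrite -big_distrr /=).
rewrite -big_distrl /= leq_mul //; apply: sum_dvd_progression; exact: zQ.
Qed.

(** The bound telescopes, from [1/p^2 <= 1/(p-1) - 1/p]. *)
Lemma sum_divn_sq (Y z Z : nat) : (0 < z)%N ->
  (z * \sum_(z.+1 <= p < Z.+1) Y %/ p ^ 2 <= Y)%N.
Proof.
move=> z0; case: (leqP Z z) => zZ; first by rewrite big_geq ?ltnS // muln0.
have H k : (\sum_(z.+1 <= p < (z + k).+1) Y %/ p ^ 2)%N%:R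
    <= Y%:R / z%:R - Y%:R / (z + k)%N%:R :> rat.
  elim: k => [|k IHk]; first by rewrite addn0 subrr big_geq.
  rewrite addnS big_nat_recr /=; last by rewrite ltnS leq_addr.
  rewrite natrD; set s := (_%:R) in IHk *.
  set p := (z + k).+1; have pz : ((z + k)%N%:R : rat) = p%:R - 1.
    by rewrite /p -natr1 addrK.
  have p1 : 1 < (p%:R : rat) by rewrite ltr1n /p; lia.
  have Yp : (Y %/ p ^ 2)%N%:R <= Y%:R / p%:R ^+ 2 :> rat.
    rewrite ler_pdivlMr; last by rewrite exprn_gt0 //; lra.
    by rewrite -natrX -natrM ler_nat leq_trunc_div.
  have Y0 : (0 : rat) <= Y%:R by [].
  have : Y%:R / p%:R ^+ 2 <= Y%:R / (p%:R - 1) - Y%:R / p%:R :> rat.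
    rewrite -mulrBr ler_wpM2l // -subr_ge0.
    have -> : (p%:R - 1)^-1 - p%:R^-1 - (p%:R ^+ 2)^-1 = ((p%:R - 1) * p%:R ^+ 2)^-1 :> rat.
      by field; rewrite ?expf_neq0; lra.
    by rewrite invr_ge0 mulr_ge0 ?exprn_ge0; lra.
  by move: IHk; rewrite pz => *; lra.
have := H (Z - z)%N; rewrite (subnKC (ltnW zZ)) => {}H.
rewrite -(ler_nat rat) natrM mulrC -ler_pdivlMr ?ltr0n //.
apply: le_trans H _; rewrite lerBlDr lerDl mulr_ge0 ?invr_ge0 //.
Qed.

(** Terms with [p <= T] are at most [Y] each, the others at most [Y / T]. The cut-off [T] is free
    and replaces a logarithmic estimate. *)
Lemma sum_divn (Y z T W : nat) : (0 < T)%N ->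
  (\sum_(z.+1 <= p < W.+1) Y %/ p <= Y * T + W * (Y %/ T))%N.
Proof.
move=> T_gt0.
have H p : (Y %/ p <= Y * (p <= T) + Y %/ T)%N.
  case: (leqP p T) => Tp /=; first by rewrite muln1 (leq_trans (leq_div _ _)) ?leq_addr.
  by rewrite muln0 leq_div2l // ltnW.
have cnt : (\sum_(z.+1 <= p < W.+1) (p <= T) <= minn W T)%N.
  elim: W => [|W IHW]; first by rewrite big_geq.
  case: (leqP W.+1 z) => Wz; first by rewrite big_geq.
  by rewrite big_nat_recr //=; lia.
apply: (@leq_trans (\sum_(z.+1 <= p < W.+1) (Y * (p <= T) + Y %/ T))%N).
  by apply: leq_sum => p _; exact: H.
rewrite big_split /= -big_distrr /= sum_nat_const_nat leq_add ?leq_mul2l ?leq_mul2r //.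
  by rewrite (leq_trans cnt) ?geq_minr ?orbT.
by rewrite subSS leq_subr orbT.
Qed.

(** Each of the two sums is at most [X Y / 4]. In the first, the parts [Y / p^2] and [1] contribute
    at most [X Y / 8] each, by the lower bound on [z] and the upper bound on [Z]. *)
Lemma sieve_bound (m z Q X Y Z : nat) : (0 < m)%N -> (0 < Q)%N ->
    (16 * m <= z)%N -> (16 * m * Z <= Y)%N -> (X <= Y)%N -> (4096 * Q <= X)%N ->
  (2 * (\sum_(z.+1 <= p < Z.+1) X * (m.*2 * (Y %/ p ^ 2).+1)
      + \sum_(z.+1 <= p < (4 * Q * X).+1) (X %/ p).+1 * (Y %/ p).+1) <= X * Y)%N.
Proof.
move=> m_gt0 Q_gt0 mz mZ XY QX.
have z_gt0 : (0 < z)%N by lia.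
have S1 : (4 * \sum_(z.+1 <= p < Z.+1) X * (m.*2 * (Y %/ p ^ 2).+1) <= X * Y)%N.
  rewrite -big_distrr -big_distrr /=.
  under eq_bigr => p _ do rewrite -addn1.
  rewrite big_split /= sum_nat_const_nat muln1 subSS.
  have := sum_divn_sq Y Z z_gt0; move: (\sum_(_ <= _ < _) _)%N => s sY.
  rewrite mulnCA leq_mul2l; apply/orP; right.
  have : (16 * m * s <= Y)%N by apply: leq_trans sY; rewrite leq_mul2r mz orbT.
  have : (16 * m * (Z - z) <= Y)%N.
    by apply: leq_trans mZ; rewrite leq_mul2l leq_subr orbT.
  by lia.
have S2 : (4 * \sum_(z.+1 <= p < (4 * Q * X).+1) (X %/ p).+1 * (Y %/ p).+1 <= X * Y)%N.
  have H p : ((X %/ p).+1 * (Y %/ p).+1 <= (X * Y) %/ p ^ 2 + (Y %/ p + Y %/ p) + 1)%N.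
    have : ((X %/ p) * (Y %/ p) <= (X * Y) %/ p ^ 2)%N.
      case: p => [|p]; first by rewrite !divn0.
      by rewrite leq_divRL ?expn_gt0 // expnS expn1 mulnACA leq_mul // leq_trunc_div.
    by have : (X %/ p <= Y %/ p)%N by [exact: leq_div2r]; lia.
  set S := (\sum_(_ <= _ < _) _)%N.
  set SB := (\sum_(z.+1 <= p < (4 * Q * X).+1) (X * Y) %/ p ^ 2)%N.
  set SC := (\sum_(z.+1 <= p < (4 * Q * X).+1) Y %/ p)%N.
  have hS : (S <= SB + 2 * SC + 4 * Q * X)%N.
    apply: (@leq_trans (\sum_(z.+1 <= p < (4 * Q * X).+1)
        ((X * Y) %/ p ^ 2 + (Y %/ p + Y %/ p) + 1))%N).
      by apply: leq_sum => p _; exact: H.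
    rewrite !big_split /= sum_nat_const_nat muln1 subSS mul2n -addnn.
    by rewrite leq_add2l leq_subr.
  have hB : (16 * SB <= X * Y)%N.
    apply: leq_trans (sum_divn_sq (X * Y) (4 * Q * X) z_gt0).
    by rewrite leq_mul2r; apply/orP; right; lia.
  (* With the cut-off [128 Q], the bound for [S] has four parts: [SB], [256 Q Y], [8 Q X] times
     [Y / (128 Q)], and [4 Q X]. Each is at most [X Y / 16]. *)
  have T_gt0 : (0 < 128 * Q)%N by lia.
  have hC : (SC <= Y * (128 * Q) + 4 * Q * X * (Y %/ (128 * Q)))%N by exact: sum_divn.
  have hT : (X * (Y %/ (128 * Q) * (128 * Q)) <= X * Y)%N.
    by rewrite leq_mul2l leq_trunc_div orbT.
  have hQ : (Y * (4096 * Q) <= Y * X)%N by rewrite leq_mul2l QX orbT.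
  have hX : (X * (64 * Q) <= X * Y)%N by rewrite leq_mul2l; apply/orP; right; lia.
  move: (Y %/ (128 * Q))%N hC hT => t hC hT.
  by nia.
by lia.
Qed.

(** * Consequences of the abc conjecture *)

Lemma rad_dvd (x N : nat) : (forall p, prime p -> (p %| x)%N -> (p %| N)%N) ->
  (rad x %| N)%N.
Proof.
move=> H; rewrite /rad.
have : all (fun p => prime p && (p %| N)%N) (primes x).
  by apply/allP => p; rewrite mem_primes => /and3P[p_pr _ px]; rewrite p_pr H.
elim: (primes x) (primes_uniq x) => [|p s IHs] /=; first by rewrite big_nil dvd1n.
move=> /andP[ps us] /andP[/andP[p_pr pN] sN]; rewrite big_cons.
rewrite Gauss_dvd ?pN ?IHs // prime_coprime //.
apply: contraNN ps; rewrite Euclid_dvd_prod // big_has => /hasP[q qs].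
rewrite /= dvdn_prime2 // => [/eqP -> //|].
by have /andP[] := allP sN q qs.
Qed.

Lemma rad_gt0 (x : nat) : (0 < rad x)%N.
Proof.
by rewrite /rad big_seq prodn_cond_gt0 // => p; rewrite mem_primes => /andP[/prime_gt0].
Qed.

(** Write [t + s = e1 p^2] and [t - s = e2 q^2]. The radical divides [r (p e1) (q e2)], and a
    further factor [p q] turns this into [r (t^2 - s^2)]. *)
Lemma rad_diff_squares (s t p q r : nat) : (0 < s)%N -> (s < t)%N -> prime p -> prime q ->
    (p ^ 2 %| t + s)%N -> (q ^ 2 %| t - s)%N -> (0 < r)%N ->
    (forall l, prime l -> (l %| s * t)%N -> (l %| r)%N) ->
  (rad (s ^ 2 * (t ^ 2 - s ^ 2) * t ^ 2) * (p * q) <= r * t ^ 2)%N.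
Proof.
move=> s0 st p_pr q_pr /dvdnP[e1 E1] /dvdnP[e2 E2] r0 lr.
have e10 : (0 < e1)%N by case: (posnP e1) => // e0; move: E1; rewrite e0 mul0n; lia.
have e20 : (0 < e2)%N by case: (posnP e2) => // e0; move: E2; rewrite e0 mul0n; lia.
have rad_le : (rad (s ^ 2 * (t ^ 2 - s ^ 2) * t ^ 2) <= r * ((p * e1) * (q * e2)))%N.
  apply: dvdn_leq; first by rewrite !muln_gt0 r0 e10 e20 (prime_gt0 p_pr) (prime_gt0 q_pr).
  apply: rad_dvd => l l_pr; rewrite 2!(Euclid_dvdM _ _ l_pr) !(Euclid_dvdX _ _ l_pr) /=.
  rewrite subn_sqr Euclid_dvdM // E1 E2.
  have lrst : (l %| s)%N || (l %| t)%N -> (l %| r)%N by rewrite -Euclid_dvdM //; exact: lr.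
  rewrite !andbT => /orP[/orP[ls|/orP[]]|lt].
  - by rewrite dvdn_mulr // lrst // ls.
  - by rewrite !(Euclid_dvdM _ _ l_pr) orbb => /orP[] ->; rewrite ?orbT.
  - by rewrite !(Euclid_dvdM _ _ l_pr) orbb => /orP[] ->; rewrite ?orbT.
  - by rewrite dvdn_mulr // lrst // lt orbT.
apply: leq_trans (leq_mul rad_le (leqnn _)) _.
have -> : (r * (p * e1 * (q * e2)) * (p * q) = r * ((t + s) * (t - s)))%N.
  by rewrite E1 E2; lia.
by rewrite leq_mul2l mulnC -subn_sqr leq_subr orbT.
Qed.

(** Taking logarithms and eliminating [ln r] gives [(1 + eps) (ln B - ln A) <= K + 2 eps n ln B].
    The left side is at least [th ln B] and [2 eps n = th / 2], so [ln B <= 2 K / th], which fails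
    for large [B]. *)
Lemma abc_log_bound (R : realType) (n : nat) (delta eps C k3 k : R) :
    (0 < n)%N -> 0 < delta -> 0 < C -> 0 < k3 -> 0 < k ->
    eps = delta / (1 + delta) / (4 * n%:R) ->
  exists B0 : R, forall A B M r : R, 1 <= A -> 1 <= B -> B0 <= B -> 0 < M -> 0 < r ->
    powR A (1 + delta) < B -> M <= C * powR r (1 + eps) ->
    r * B <= k3 * A * M -> M <= (k * B ^+ n) ^+ 2 -> False.
Proof.
move=> n0 d0 C0 k30 k0 epsE.
(* The exponent saved: [A] is at most [B^(1 - th)]. *)
pose th := delta / (1 + delta).
have th0 : 0 < th by rewrite divr_gt0 //; lra.
have n0' : 0 < (n%:R : R) by rewrite ltr0n.
have eps0 : 0 < eps by rewrite epsE divr_gt0 // mulr_gt0.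
pose K := ln C + (1 + eps) * ln k3 + eps * (2 * ln k).
exists (expR (2 * K / th) + 1) => A B M r A1 B1 B0 M0 r0 AB Mr rB MB.
have A0 : 0 < A by lra.
have Bp : 0 < B by lra.
have x_gt : 2 * K / th < ln B.
  rewrite -(expRK (2 * K / th)) ltr_ln ?posrE ?expR_gt0 //; lra.
have xAB : (1 + delta) * ln A <= ln B.
  rewrite -ln_powR ler_ln ?posrE ?powR_gt0 //; exact: ltW.
have h1 : ln M <= ln C + (1 + eps) * ln r.
  rewrite -ln_powR -lnM ?posrE ?powR_gt0 // ler_ln ?posrE // mulr_gt0 // powR_gt0 //.
have h2 : ln r + ln B <= ln k3 + ln A + ln M.
  by rewrite -!lnM ?posrE ?mulr_gt0 // ler_ln ?posrE ?mulr_gt0.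
have h3 : ln M <= 2 * (ln k + n%:R * ln B).
  have -> : 2 * (ln k + n%:R * ln B) = ln ((k * B ^+ n) ^+ 2).
    by rewrite lnXn ?mulr_gt0 ?exprn_gt0 // lnM ?posrE ?exprn_gt0 // lnXn // !mulr_natl.
  by rewrite ler_ln ?posrE ?exprn_gt0 ?mulr_gt0 ?exprn_gt0.
have hth : th * ln B <= ln B - ln A.
  have -> : th = 1 - (1 + delta)^-1 by rewrite /th; field; lra.
  rewrite mulrBl mul1r lerB // mulrC ler_pdivlMr; last by lra.
  by rewrite mulrC.
have e1 : eps * n%:R * 4 = th by rewrite epsE /th; field; rewrite ?gt_eqF //; lra.
have h4 : (1 + eps) * (ln r) <= (1 + eps) * (ln k3 + ln A + ln M - ln B).
  by rewrite ler_wpM2l; lra.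
have h5 : eps * ln M <= eps * (2 * (ln k + n%:R * ln B)) by rewrite ler_wpM2l // ltW.
have lnA0 : 0 <= ln A by rewrite ln_ge0.
have lnAB : 0 <= ln B - ln A by move: xAB; nra.
have h6 : th * ln B <= (1 + eps) * (ln B - ln A).
  by apply: le_trans hth _; rewrite mulrDl mul1r lerDl mulr_ge0 // ltW.
have h7 : 2 * K < ln B * th by rewrite -ltr_pdivrMr.
have h8 : eps * (n%:R * ln B) = th / 4 * ln B by rewrite -e1; field.
rewrite /K in h7; move: h1 h4 h5 h6 h7 h8; rewrite !mulrDr ?mulrDl; lra.
Qed.

(** The large squares make the radical of [s^2 (t^2 - s^2) t^2] at most a constant times
    [A t^2 / B], a power of [B] below [t^2], against abc. *)
Lemma abc_diff_squares (m kap : nat) (delta : Rdefinitions.R) :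
    abc_conjecture -> (0 < m)%N -> (0 < kap)%N -> 0 < delta ->
  exists B0 : nat, forall A B s t p q r : nat,
    (0 < A)%N -> (B0 <= B)%N ->
    powR (A%:R : Rdefinitions.R) (1 + delta) < B%:R ->
    (0 < s)%N -> (s < t)%N -> coprime s t ->
    prime p -> prime q -> (p ^ 2 %| t + s)%N -> (q ^ 2 %| t - s)%N ->
    (B <= kap * p)%N -> (B <= kap * q)%N ->
    (0 < r <= kap * A * B)%N ->
    (forall l, prime l -> (l %| s * t)%N -> (l %| r)%N) ->
    (t <= kap * B ^ m)%N -> False.
Proof.
move=> abc m0 kap0 d0.
pose eps := delta / (1 + delta) / (4 * m%:R).
have d1 : 0 < 1 + delta by lra.
have eps0 : 0 < eps by rewrite !divr_gt0 // mulr_gt0 // ltr0n.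
have [C0 abcC] := abc eps eps0.
pose C := `|C0| + 1.
(* In [kap^3], two factors come from [p] and [q] being at least [B / kap], the third from
   [r <= kap A B]. *)
have [//|||B1 B1P] := @abc_log_bound _ m delta eps C (kap ^ 3)%N%:R kap%:R m0 d0 _ _ _ erefl.
- by rewrite ltr_wpDl.
- by rewrite ltr0n expn_gt0 kap0.
- by rewrite ltr0n.
exists (Num.trunc `|B1|).+1 => A B s t p q r A0 B0 AB s0 st cst p_pr q_pr pst qst Bp Bq.
move=> /andP[r0 rAB] lr tB.
have B0' : (0 < B)%N by exact: leq_trans B0.
have t0 : (0 < t)%N by exact: leq_trans st.
pose ra := rad (s ^ 2 * (t ^ 2 - s ^ 2) * t ^ 2).
apply: (B1P A%:R B%:R (t ^ 2)%N%:R ra%:R) => //.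
- by rewrite ler1n.
- by rewrite ler1n.
- apply: le_trans (ler_norm _) _; apply: ltW; apply: lt_le_trans (truncnS_gt _) _.
  by rewrite ler_nat.
- by rewrite ltr0n expn_gt0 t0.
- by rewrite ltr0n rad_gt0.
- have st2 : (s ^ 2 < t ^ 2)%N by rewrite ltn_sqr.
  apply: le_trans (abcC (s ^ 2)%N (t ^ 2 - s ^ 2)%N (t ^ 2)%N _ _ _ _) _.
  + by rewrite expn_gt0 s0.
  + by rewrite subn_gt0.
  + rewrite /coprime -(gcdnDr (s ^ 2) (t ^ 2 - s ^ 2)) subnK 1?ltnW //.
    by rewrite -/(coprime _ _) coprimeXl ?coprimeXr.
  + by rewrite [LHS]subnKC // ltnW.
  rewrite ler_wpM2r ?powR_ge0 //; apply: le_trans (ler_norm _) _.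
  by rewrite lerDl.
- rewrite -!natrM ler_nat.
  have := rad_diff_squares s0 st p_pr q_pr pst qst r0 lr; rewrite -/ra => hra.
  rewrite -(leq_pmul2r B0').
  apply: (@leq_trans (kap ^ 2 * (ra * (p * q)))).
    rewrite -mulnA (_ : kap ^ 2 * (ra * (p * q)) = ra * ((kap * p) * (kap * q)))%N; last by lia.
    by rewrite leq_mul2l leq_mul ?orbT.
  apply: (@leq_trans (kap ^ 2 * (kap * A * B * t ^ 2))).
    by rewrite leq_mul2l (leq_trans hra) ?orbT // leq_mul2r rAB orbT.
  by rewrite expnS; lia.
- by rewrite -natrX -natrM -natrX ler_nat leq_sqr.
Qed.

Lemma abc_trinom_disc (m kap : nat) (delta : Rdefinitions.R) :
    abc_conjecture -> (0 < m)%N -> ~~ odd m -> (0 < kap)%N -> 0 < delta ->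
  exists B0 : nat, forall A B a b p q : nat,
    (0 < A)%N -> (B0 <= B)%N ->
    powR (A%:R : Rdefinitions.R) (1 + delta) < B%:R ->
    (0 < a <= 2 * A)%N -> (0 < b <= 2 * B)%N ->
    coprime (m ^ m * a ^ m.+1) (m.+1 ^ m.+1 * b ^ m) ->
    trinom_disc m (- a%:Z) b%:Z != 0 ->
    prime p -> prime q ->
    ((p ^ 2)%N %| trinom_disc m a%:Z b%:Z)%Z ->
    ((q ^ 2)%N %| trinom_disc m (- a%:Z) b%:Z)%Z ->
    (B <= kap * p)%N -> (B <= kap * q)%N -> False.
Proof.
move=> abc m0 m_even kap0 d0.
pose n := m.+1.
(* [4 m n] serves the bound [m a n b <= k A B], and [2^n n^n] the bounds on [u] and [v] by
   [k B^n]. *)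
pose k := (kap + (m * n * 4 + 2 ^ n * n ^ n))%N.
have k0 : (0 < k)%N by rewrite addn_gt0 kap0.
have [B0 B0P] := @abc_diff_squares n k delta abc (ltn0Sn m) k0 d0.
exists B0 => A B a b p q A0 BB AB /andP[a0 aA] /andP[b0 bB] cop Dn0 p_pr q_pr pD qD Bp Bq.
set u := (m ^ m * a ^ n)%N; set v := (n ^ n * b ^ m)%N.
have DpE : trinom_disc m a%:Z b%:Z = (v + u)%N%:Z.
  by rewrite /trinom_disc PoszD !PoszM -!rmorphXn /= !natz.
have DmE : trinom_disc m (- a%:Z) b%:Z = v%:Z - u%:Z.
  rewrite /trinom_disc exprNn -signr_odd /= m_even expr1 mulN1r mulrN !PoszM.
  by rewrite -!rmorphXn /= !natz.
have A_le_B : (A <= B)%N.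
  rewrite -(ler_nat Rdefinitions.R) (le_trans _ (ltW AB)) //.
  rewrite -[leLHS]powRr1 ?ler0n // ler_powR ?ler1n //; lra.
have B_gt0 : (0 < B)%N by exact: leq_trans A_le_B.
have u0 : (0 < u)%N by rewrite muln_gt0 !expn_gt0 m0 a0.
have v0 : (0 < v)%N by rewrite muln_gt0 !expn_gt0 b0.
have uv : u != v by apply: contraNneq Dn0; rewrite DmE => ->; rewrite subrr.
have ub : (u <= k * B ^ n)%N.
  apply: (@leq_trans (n ^ n * (2 * B) ^ n)); last first.
    by rewrite expnMn mulnA leq_mul2r; apply/orP; right; rewrite /k mulnC; lia.
  rewrite leq_mul // ?leq_exp2r //; last by rewrite (leq_trans aA) // leq_mul2l.
  apply: (@leq_trans (n ^ m)); first by rewrite leq_exp2r // leqnSn.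
  by rewrite leq_pexp2l.
have vb : (v <= k * B ^ n)%N.
  apply: (@leq_trans (n ^ n * (2 * B) ^ n)); last first.
    by rewrite expnMn mulnA leq_mul2r; apply/orP; right; rewrite /k mulnC; lia.
  rewrite leq_mul // (@leq_trans ((2 * B) ^ m)) ?leq_exp2r // leq_pexp2l //.
  by rewrite muln_gt0.
have kB x : (B <= kap * x -> B <= k * x)%N.
  by move=> h; apply: leq_trans h _; rewrite leq_mul2r leq_addr orbT.
have rb : (0 < m * a * (n * b) <= k * A * B)%N.
  rewrite !muln_gt0 m0 a0 b0 /=.
  apply: (@leq_trans (m * (2 * A) * (n * (2 * B)))).
    by rewrite !leq_mul.
  have -> : (m * (2 * A) * (n * (2 * B)) = (m * n * 4) * A * B)%N by lia.
  by rewrite !leq_mul2r; apply/orP; right; apply/orP; right; rewrite /k; lia.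
have lr l : prime l -> (l %| u * v)%N -> (l %| m * a * (n * b))%N.
  move=> l_pr; rewrite !(Euclid_dvdM _ _ l_pr) !(Euclid_dvdX _ _ l_pr).
  by case/orP => /orP[] /andP[-> _]; rewrite ?orbT.
rewrite DpE /= dvdzE /= in pD; rewrite DmE dvdzE /= in qD.
(* The larger of [u] and [v] plays the role of [t]; the sum and the absolute difference are
   symmetric. *)
have [uv'|vu|E] := ltngtP u v; last by rewrite E eqxx in uv.
- apply: (B0P A B u v p q (m * a * (n * b))%N) => //; try exact: kB.
  by move: qD; rewrite distnEl // ltnW.
- apply: (B0P A B v u p q (m * a * (n * b))%N) => //; try exact: kB.
  + by rewrite coprime_sym.
  + by rewrite addnC.
  + by move: qD; rewrite distnEr // ltnW.
  + by move=> l l_pr; rewrite mulnC; exact: lr.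
Qed.

(** * Counting *)

Lemma irreducible_trinom (l m : nat) (a b : int) (g : 'F_l) :
    prime l -> (0 < m)%N -> (l %| a)%Z -> b%:~R = - g ->
    (forall (x : 'F_l) d, x ^+ m.+1 = g ^+ d -> (m.+1 %| d)%N) ->
  irreducible_poly (map_poly (intr : int -> rat) (trinom m.+1 a b)).
Proof.
move=> l_pr m_gt0; rewrite dvdz_Fp // => /eqP a0 bg g_free.
apply: (irreducible_map_Fp l_pr); first exact: trinom_monic.
rewrite /trinom !rmorphD rmorphM /= map_polyXn !map_polyC /= a0 bg mul0r addr0 polyCN.
exact: irreducible_XnsubC.
Qed.

Lemma not_squarefree_prime (D : int) : D != 0 -> ~ squarefree_int D ->
  exists2 p, prime p & ((p ^ 2)%N %| D)%Z.
Proof.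
move=> D0 nsq; apply: contrapT => nop; apply: nsq => d dD.
apply/eqP; case: (boolP (`|d| == 1)) => // d1; exfalso; apply: nop.
have d0 : d != 0 by apply: contraNneq D0 => d0; rewrite d0 mul0r dvd0z in dD.
have [|p p_pr pd] := @pdivP `|d|%N; first by lia.
exists p => //; apply: dvdz_trans dD.
by rewrite !dvdzE /= abszM expnS expn1 dvdn_mul.
Qed.

Lemma mem_zrange (A : nat) (x : int) : `|x| <= (2 * A)%N%:Z -> x \in zrange A.
Proof.
move=> xA; apply/mapP; exists (absz (x + (2 * A)%N%:Z)); last by lia.
by rewrite mem_iota; lia.
Qed.

Lemma card_le_cardM (n A B : nat) (T : finType) (S : {set T}) (f : T -> int * int) :
    {in S &, injective f} -> (forall x, x \in S -> inM n A B (f x)) ->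
  (#|S| <= cardM n A B)%N.
Proof.
move=> f_inj fM; rewrite /cardM -size_filter cardE -(size_map f).
apply: uniq_leq_size.
  rewrite map_inj_in_uniq ?enum_uniq // => x y; rewrite !mem_enum; exact: f_inj.
move=> _ /mapP[x + ->]; rewrite mem_enum => /fM.
case: (f x) => a b abM; rewrite mem_filter; apply/andP; split; first exact/asboolP.
case: abM => /andP[_ aA] /andP[_ bB] _ _.
by apply: allpairs_f; exact: mem_zrange.
Qed.

(** Once [A >= K^(1/delta)], the extra factor [A^delta] is at least [K]. *)
Lemma powR_superlinear (delta : Rdefinitions.R) (K : nat) : 0 < delta ->
  exists A0 : nat, forall A B : nat, (A0 <= A)%N ->
    powR (A%:R : Rdefinitions.R) (1 + delta) < B%:R -> (K * A <= B)%N.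
Proof.
move=> d0; exists (Num.trunc (powR (K%:R : Rdefinitions.R) delta^-1)).+1 => A B A0 AB.
have Ap : 0 < (A%:R : Rdefinitions.R) by rewrite ltr0n; exact: leq_trans A0.
rewrite -(ler_nat Rdefinitions.R) natrM; apply: le_trans (ltW AB).
rewrite powRD; last by apply/implyP => _; rewrite gt_eqF.
rewrite powRr1 ?ler0n // mulrC ler_pM2l //.
have -> : (K%:R : Rdefinitions.R) = powR (powR K%:R delta^-1) delta.
  by rewrite -powRrM mulVf ?gt_eqF // powRr1.
apply: ge0_ler_powR; rewrite ?nnegrE ?powR_ge0 //; try exact: ltW.
apply: ltW; apply: lt_le_trans (truncnS_gt _) _; by rewrite ler_nat.
Qed.

Lemma dvdn_natr_Fp (p k : nat) : prime p -> (p %| k)%N = (k%:R == 0 :> 'F_p).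
Proof. by move=> p_pr; rewrite (dvdn_pcharf (pchar_Fp p_pr)). Qed.

Lemma modn_natr_Fp (p j k : nat) : prime p -> j = k %[mod p] -> j%:R = k%:R :> 'F_p.
Proof. by move=> p_pr E; rewrite -(Fp_nat_mod p_pr j) E Fp_nat_mod. Qed.

Lemma prime_dvd_prod_ord (z p : nat) (P : pred nat) : prime p -> (p <= z)%N ->
  (forall q, P q -> prime q) -> (p %| \prod_(q < z.+1 | P q) q)%N = P p.
Proof.
move=> p_pr pz Ppr; apply/idP/idP.
  rewrite Euclid_dvd_prod // big_has_cond => /hasP[q _ /andP[Pq]].
  by rewrite (dvdn_prime2 p_pr (Ppr _ Pq)) => /eqP ->.
move=> Pp; have pz1 : (p < z.+1)%N by [].
by rewrite (bigD1 (Ordinal pz1)) //= dvdn_mulr.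
Qed.

(** The residues make exactly one term of the discriminant a unit modulo each [p <= z], so not even
    [p] divides it. If [p] divides [m + 1], then [p] does not divide [a0] and [m] is -1 modulo [p];
    otherwise [p] divides [a0] but not [b0]. *)
Lemma small_prime_residues (l m z : nat) (g : 'F_l) :
    prime l -> (0 < m)%N -> (l <= z)%N -> ~~ (l %| m.+1)%N -> g != 0 ->
  exists a0 b0 : nat, [/\ (l %| a0)%N, b0%:R = - g &
    forall a b p, prime p -> (p <= z)%N -> a = a0 %[mod p] -> b = b0 %[mod p] ->
      ~~ disc_sq m p a b].
Proof.
move=> l_pr m_gt0 lz ln g0.
pose a0 := (\prod_(q < z.+1 | prime q && ~~ (q %| m.+1)%N) q)%N.
pose P := (\prod_(q < z.+1 | prime q && (q != l :> nat)) q)%N.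
have a0P p : prime p -> (p <= z)%N -> (p %| a0)%N = ~~ (p %| m.+1)%N.
  move=> p_pr pz.
  by rewrite /a0 (prime_dvd_prod_ord (P := fun q => prime q && ~~ (q %| m.+1)%N)) //
    ?p_pr // => q /andP[].
have PP p : prime p -> (p <= z)%N -> (p %| P)%N = (p != l).
  move=> p_pr pz.
  by rewrite /P (prime_dvd_prod_ord (P := fun q => prime q && (q != l))) //
    ?p_pr // => q /andP[].
have lP : coprime l P by rewrite prime_coprime // PP // eqxx.
(* [b0] is [- g] modulo [l] and 1 modulo every other prime up to [z]. *)
pose b0 := chinese l P (- g : 'F_l) 1.
have b0l : b0%:R = - g :> 'F_l.
  by rewrite (modn_natr_Fp l_pr (chinese_modl lP _ _)) natr_Zp.
exists a0, b0; split=> //; first by rewrite a0P.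
move=> a b p p_pr pz aE bE.
have {}aE := modn_natr_Fp p_pr aE; have {}bE := modn_natr_Fp p_pr bE.
have b0p : ~~ (p %| m.+1)%N -> (b0%:R : 'F_p) != 0.
  have [El|pl] := eqVneq p l; first by move: p_pr pz aE bE; rewrite El b0l oppr_eq0.
  have pP : (p %| P)%N by rewrite PP.
  suff -> : (b0%:R : 'F_p) = 1 by rewrite oner_eq0.
  apply: (modn_natr_Fp (k := 1) p_pr); rewrite -(modn_dvdm _ pP) chinese_modr //.
  by rewrite modn_dvdm.
have aux (s : int) : (s%:~R == 0 :> 'F_p) = (a%:R == 0 :> 'F_p) ->
    ~~ ((p ^ 2)%N %| trinom_disc m s b%:Z)%Z.
  move=> sE; apply/negP => H; have : (p %| trinom_disc m s b)%Z.
    by apply: dvdz_trans H; rewrite dvdzE /= expnS dvdn_mulr.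
  rewrite dvdz_Fp // trinom_disc_Fp -[b%:Z%:~R]/(b%:R) bE.
  have := a0P p p_pr pz; rewrite [in LHS]dvdn_natr_Fp // -aE -sE dvdn_natr_Fp //.
  have [n0 /negbT s0|n0 s0] := eqVneq (m.+1%:R : 'F_p) 0.
    have -> : (m%:R : 'F_p) = -1 by apply/eqP; rewrite -addr_eq0 natr1 n0.
    rewrite n0 expr0n /= mul0r add0r mulf_eq0 !expf_eq0 oppr_eq0 oner_eq0.
    by rewrite (negbTE s0) !andbF.
  rewrite (eqP s0) [X in _ + _ * X]expr0n mulr0 addr0 mulf_eq0 !expf_eq0 (negbTE n0).
  by rewrite andbF (negbTE (b0p _)) ?andbF // dvdn_natr_Fp.
by rewrite /disc_sq negb_or !aux // rmorphN /= oppr_eq0.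
Qed.

Lemma prime_dvd_fact (p z : nat) : prime p -> (p %| z`!)%N = (p <= z)%N.
Proof.
move=> p_pr; apply/idP/idP => [|pz]; last by rewrite dvdn_fact // prime_gt0.
rewrite fact_prod Euclid_dvd_prod // big_has => /hasP[q].
rewrite mem_index_iota => /andP[q0 qz] pq.
exact: leq_trans (dvdn_leq q0 pq) qz.
Qed.

(** As [m] and [m + 1] are coprime, a common prime divides [a] or [b], and it is at most [m],
    [m + 1] or [a], hence at most [Z]. All exponents are at least 2, so its square divides both
    terms and the discriminant, which the sieve excludes. *)
Lemma not_disc_sq_coprime (m Z a b : nat) : (1 < m)%N -> (m.+1 <= Z)%N ->
    (0 < a <= Z)%N -> (forall p, prime p -> (p <= Z)%N -> ~~ disc_sq m p a b) ->
  coprime (m ^ m * a ^ m.+1) (m.+1 ^ m.+1 * b ^ m).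
Proof.
move=> m1 mZ /andP[a0 aZ] H.
have D (p u v w x : nat) : (1 < u)%N -> (1 < v)%N -> (p %| w)%N -> (p %| x)%N ->
    [/\ (p ^ 2 %| w ^ u)%N & (p ^ 2 %| x ^ v)%N].
  by move=> u1 v1 pw px; split;
    [apply: dvdn_trans (dvdn_exp2r 2 pw) _ | apply: dvdn_trans (dvdn_exp2r 2 px) _];
    rewrite dvdn_exp2l.
have sq p : (p ^ 2 %| m ^ m * a ^ m.+1)%N -> (p ^ 2 %| m.+1 ^ m.+1 * b ^ m)%N ->
    disc_sq m p a b.
  move=> h1 h2; apply/orP; left.
  rewrite /trinom_disc rpredD // dvdzE !abszM !abszX /= !natz //=.
apply: contraT => ncop.
have [|p p_pr] := @pdivP (gcdn (m ^ m * a ^ m.+1) (m.+1 ^ m.+1 * b ^ m)).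
  rewrite ltn_neqAle eq_sym ncop gcdn_gt0 muln_gt0 !expn_gt0 a0.
  by rewrite (ltnW m1).
rewrite dvdn_gcd !(Euclid_dvdM _ _ p_pr) !(Euclid_dvdX _ _ p_pr) /= !andbT.
move=> /andP[/orP[/andP[pm _]|pa] /orP[pn|/andP[pb _]]].
- have : (p %| 1)%N by rewrite -(dvdn_addr _ pm) addn1.
  by rewrite Euclid_dvd1.
- have [d1 d2] := D p m m m b m1 m1 pm pb.
  have pZ : (p <= Z)%N by rewrite (leq_trans (dvdn_leq (ltnW m1) pm)) // ltnW.
  by have := H p p_pr pZ; rewrite (sq p (dvdn_mulr _ d1) (dvdn_mull _ d2)).
- have [d1 d2] := D p m.+1 m.+1 a m.+1 (ltnW m1) (ltnW m1) pa pn.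
  have pZ : (p <= Z)%N by rewrite (leq_trans (dvdn_leq _ pn)).
  by have := H p p_pr pZ; rewrite (sq p (dvdn_mull _ d1) (dvdn_mulr _ d2)).
- have [d1 d2] := D p m.+1 m a b (ltnW m1) m1 pa pb.
  have pZ : (p <= Z)%N by rewrite (leq_trans (dvdn_leq a0 pa)).
  by have := H p p_pr pZ; rewrite (sq p (dvdn_mull _ d1) (dvdn_mull _ d2)).
Qed.

(** The offset [Q (A / Q + 1)] exceeds [A], and [i + 2 <= A / Q] keeps the term below
    [2 Q (A / Q)]. *)
Lemma progression_range (Q A r i : nat) : (0 < Q)%N -> (i < (A %/ Q).-1)%N ->
  (A <= r %% Q + Q * (A %/ Q).+1 + Q * i <= 2 * A)%N.
Proof.
move=> Q0 iA; have := ltn_pmod r Q0; have := ltn_pmod A Q0; have := divn_eq A Q.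
move: (A %/ Q)%N (A %% Q)%N (r %% Q)%N iA => q s t iq E sQ tQ.
have : (Q * i.+2 <= Q * q)%N by rewrite leq_mul2l; apply/orP; right; lia.
by lia.
Qed.

Lemma progression_mod (Q A r i p : nat) : (p %| Q)%N ->
  (r %% Q + Q * (A %/ Q).+1 + Q * i = r %[mod p])%N.
Proof.
move=> pQ; rewrite -addnA -mulnDr -(modnDm _ (Q * _)).
by rewrite (eqP (dvdn_mulr _ pQ)) addn0 modn_mod modn_dvdm.
Qed.

Lemma leq_progression_size (Q A : nat) : (0 < Q)%N -> (2 <= (A %/ Q).-1)%N ->
  (A <= 2 * Q * (A %/ Q).-1)%N.
Proof.
move=> Q0 A2; have := ltn_pmod A Q0; have := divn_eq A Q.
move: (A %/ Q)%N (A %% Q)%N A2 => q s q2 E sQ.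
have : (Q * q.+1 <= Q * (2 * q.-1))%N by rewrite leq_mul2l; apply/orP; right; lia.
by lia.
Qed.

Lemma card_good_half (X Y : nat) (bad : 'I_X -> 'I_Y -> bool) :
  (2 * (\sum_(i < X) \sum_(j < Y) bad i j) <= X * Y)%N ->
  (X * Y <= 2 * #|[set ij : 'I_X * 'I_Y | ~~ bad ij.1 ij.2]|)%N.
Proof.
have -> : (\sum_(i < X) \sum_(j < Y) bad i j =
    #|[set ij : 'I_X * 'I_Y | bad ij.1 ij.2]|)%N.
  rewrite pair_big /= -sum1_card [RHS]big_mkcond /=.
  by apply: eq_bigr => ij _; rewrite inE; case: (bad _ _).
have := cardsC [set ij : 'I_X * 'I_Y | bad ij.1 ij.2].
rewrite card_prod !card_ord.
have -> : ~: [set ij : 'I_X * 'I_Y | bad ij.1 ij.2]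
    = [set ij : 'I_X * 'I_Y | ~~ bad ij.1 ij.2] by apply/setP => ij; rewrite !inE.
by move: #|_| #|_| => x y; lia.
Qed.

Theorem theorem1 :
  abc_conjecture ->
  forall n : nat, (5 <= n)%N -> odd n -> (n %% 4 = 1)%N ->
  forall delta0 : Rdefinitions.R, 0 < delta0 ->
  exists c : Rdefinitions.R, 0 < c /\
  exists A0 : nat, forall A B : nat,
    (A0 <= A)%N -> (1 < A)%N -> (1 < B)%N ->
    powR (A%:R : Rdefinitions.R) (1 + delta0) < B%:R ->
    c * A%:R * B%:R <= (cardM n A B)%:R.
Proof.
move=> abc [//|m] n5 n_odd n4 delta d0.
have m_gt1 : (1 < m)%N by lia.
have m_gt0 := ltnW m_gt1.
have m4 : (4 %| m)%N by lia.
have m_even : ~~ odd m by lia.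
have [l l_pr nl] : exists2 l, prime l & (m.+1 %| l.-1)%N.
  by apply: exists_prime_1mod; lia.
have ln : ~~ (l %| m.+1)%N.
  rewrite gtnNdvd //; have := dvdn_leq _ nl; have := prime_gt1 l_pr; lia.
have [g g0 g_free] := Fp_power_free l_pr (ltn0Sn m) nl.
(* Large enough for the sieve ([16 m <= z]), and at least [l], so that the condition modulo [l] is
   among the congruences modulo [Q]. *)
pose z := (16 * m + m.+1 + l)%N.
have lz : (l <= z)%N by rewrite leq_addl.
have [a0 [b0 [la0 b0g small]]] := small_prime_residues l_pr m_gt0 lz ln g0.
have [Q [Q_gt0 dvdQ coQ]] : exists Q, [/\ (0 < Q)%N,
    forall p, prime p -> (p <= z)%N -> (p %| Q)%N &
    forall p, prime p -> (z < p)%N -> coprime p Q].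
  exists z`!; split=> [|p p_pr|p p_pr]; rewrite ?fact_gt0 ?prime_coprime //.
    by rewrite prime_dvd_fact.
  by rewrite prime_dvd_fact // -ltnNge.
(* Primes [p > Z] will satisfy [B <= 32 m Q p], see [Z_lt]. *)
have kap_gt0 : (0 < 32 * m * Q)%N by rewrite !muln_gt0 m_gt0.
have [B0 abcB] := abc_trinom_disc abc m_gt0 m_even kap_gt0 d0.
(* This factor makes [2 A <= Z], so that all prime divisors of [a] lie within the sieved range. *)
have [A1 supA] := powR_superlinear (Q * (32 * m + 1)) d0.
(* [A <= 2 Q X], [B <= 2 Q Y], and at least half of the [X Y] pairs survive, so
   [A B <= 8 Q^2 #|S|]. *)
exists ((8 * Q ^ 2)%N%:R^-1); split; first by rewrite invr_gt0 ltr0n muln_gt0 expn_gt0 Q_gt0.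
have [T TE] : exists T, T = (4096 * Q)%N by exists (4096 * Q)%N.
exists (A1 + B0 + Q * (T + 2) + m.+1)%N => A B A_ge A_gt1 B_gt1 AB.
have KAB : (Q * (32 * m + 1) * A <= B)%N by apply: supA AB; lia.
have A_le_B : (A <= B)%N.
  by apply: leq_trans KAB; rewrite leq_pmull // muln_gt0 Q_gt0 addn1.
pose X := (A %/ Q).-1; pose Y := (B %/ Q).-1; pose Z := (Y %/ (16 * m))%N.
have X_ge : (4096 * Q <= X)%N.
  have : (T + 2 <= A %/ Q)%N by rewrite leq_divRL // mulnC; clear - A_ge; lia.
  by rewrite -TE /X; clear; lia.
have XY : (X <= Y)%N.
  by have := leq_div2r Q A_le_B; rewrite /X /Y; clear; lia.
have AZ : (2 * A <= Z)%N.
  have h : ((32 * m + 1) * A <= B %/ Q)%N by rewrite leq_divRL // mulnC mulnA.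
  by rewrite /Z leq_divRL ?muln_gt0 ?m_gt0 // /Y; clear - A_gt1 h; lia.
have Z_le : (16 * m * Z <= Y)%N by rewrite mulnC leq_trunc_div.
have nZ : (m.+1 <= Z)%N by apply: leq_trans AZ; clear - A_ge; lia.
have Z_lt p : (Z < p)%N -> (B <= 32 * m * Q * p)%N.
  rewrite /Z ltn_divLR ?muln_gt0 ?m_gt0 // /Y => h.
  have : (B %/ Q < (16 * m * p).+1)%N by clear - h; lia.
  rewrite ltn_divLR // => /ltnW h2; apply: leq_trans h2 _.
  have -> : (32 * m * Q * p = (32 * m * p) * Q)%N by clear; lia.
  rewrite leq_mul2r; apply/orP; right.
  have : (0 < m * p)%N by rewrite muln_gt0 m_gt0; case: (p) h => //; rewrite muln0.
  by clear; lia.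
pose a i := (a0 %% Q + Q * (A %/ Q).+1 + Q * i)%N.
pose b j := (b0 %% Q + Q * (B %/ Q).+1 + Q * j)%N.
pose bad (i : 'I_X) (j : 'I_Y) := [exists p : 'I_Z.+1, prime p && disc_sq m p (a i) (b j)].
have small_ab i j p : prime p -> (p <= z)%N -> ~~ disc_sq m p (a i) (b j).
  by move=> p_pr pz; apply: small => //; apply: progression_mod; exact: dvdQ.
have aR i : (i < X)%N -> (A <= a i <= 2 * A)%N by exact: progression_range.
have bR j : (j < Y)%N -> (B <= b j <= 2 * B)%N by exact: progression_range.
pose S := [set ij : 'I_X * 'I_Y | ~~ bad ij.1 ij.2].
have S_half : (X * Y <= 2 * #|S|)%N.
  apply: card_good_half; apply: leq_trans (sieve_bound m_gt0 Q_gt0 _ Z_le XY X_ge); last first.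
    exact: (leq_trans (leq_addr m.+1 _) (leq_addr l _)).
  rewrite leq_mul2l /=; apply: sum_disc_sq => // [|i iX].
    by rewrite /z; clear; lia.
  (* The bound [W] is [4 Q X], since [a i <= 2 A <= 4 Q X]. *)
  have /andP[h1 h2] := aR i iX; rewrite -/(a i) (leq_trans _ h1) ?(ltnW A_gt1) //=.
  apply: leq_trans h2 _.
  have : (A <= 2 * Q * X)%N by apply: leq_progression_size => //; rewrite -/X; clear - X_ge Q_gt0; lia.
  by clear; lia.
(* Each surviving pair contributes one point, [(a, b)] if admissible and [(- a, b)] otherwise; the
   absolute value keeps [f] injective. *)
pose f (ij : 'I_X * 'I_Y) : int * int :=
  if `[< inM m.+1 A B ((a ij.1)%:Z, (b ij.2)%:Z) >]
  then ((a ij.1)%:Z, (b ij.2)%:Z) else (- (a ij.1)%:Z, (b ij.2)%:Z).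
have fE ij : absz (f ij).1 = a ij.1 /\ (f ij).2 = (b ij.2)%:Z.
  by rewrite /f; case: ifP => _ /=; rewrite ?abszN.
have f_inj : injective f.
  move=> [i j] [i' j'] E; have := fE (i, j); rewrite E; case: (fE (i', j')) => -> -> /=.
  rewrite /a /b => -[/addnI/eqP + [/addnI/eqP]].
  rewrite !eqn_pmul2l // => /eqP Ei /eqP Ej.
  by congr pair; apply: val_inj.
(* A zero discriminant would be divisible by [2^2], which the congruences exclude. *)
have D0 (s : int) i j : (s = (a i)%:Z \/ s = - (a i)%:Z) -> trinom_disc m s (b j)%:Z != 0.
  move=> sE; apply/eqP => D0; have z2 : (2 <= z)%N by rewrite /z; clear - m_gt0; lia.
  apply: (negP (small_ab i j 2%N isT z2)).
  by rewrite /disc_sq; case: sE => <-; rewrite D0 dvdz0 ?orbT.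
have irr (s : int) i j : (s = (a i)%:Z \/ s = - (a i)%:Z) ->
    irreducible_poly (map_poly (intr : int -> rat) (trinom m.+1 s (b j)%:Z)).
  have la : (l %| a i)%N.
    by rewrite /dvdn /a progression_mod ?dvdQ //; exact: la0.
  move=> sE; apply: (@irreducible_trinom l m _ _ g) => //.
    by case: sE => ->; rewrite dvdzE ?abszN.
  by rewrite -b0g; apply: modn_natr_Fp => //; apply: progression_mod; exact: dvdQ.
have fM ij : ij \in S -> inM m.+1 A B (f ij).
  case: ij => i j; rewrite inE /= => good.
  have noZ p : prime p -> (p <= Z)%N -> ~~ disc_sq m p (a i) (b j).
    move=> p_pr pZ; apply: contraNN good => dsq.
    by apply/existsP; exists (Ordinal (pZ : (p < Z.+1)%N)); rewrite /= p_pr.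
  have /andP[a1 a2] := aR i (ltn_ord i); have /andP[b1 b2] := bR j (ltn_ord j).
  rewrite /f /=; case: asboolP => // nM.
  have range_s (s : int) : `|s| = (a i)%:Z ->
      (A%:Z <= `|s|) && (`|s| <= (2 * A)%N%:Z) by move=> ->; rewrite !lez_nat a1.
  have range_b : (B%:Z <= `|(b j)%:Z|) && (`|(b j)%:Z| <= (2 * B)%N%:Z).
    by rewrite /= !lez_nat b1.
  split => //; [by apply: range_s; rewrite normrN | by apply: irr; right |].
  (* If both signs fail, the discriminants are divisible by [p^2] and [q^2] respectively; the sieve
     forces [p] and [q] above [Z], and abc rules this out. *)
  rewrite disc_trinom //; apply: contrapT => /(not_squarefree_prime (D0 _ i j _)).
  case; [by right | move=> q q_pr qD].
  have nsq : ~ squarefree_int (disc_monic (trinom m.+1 (a i)%:Z (b j)%:Z)).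
    by move=> sq; apply: nM; split => //; [exact: range_s | apply: irr; left].
  rewrite disc_trinom // in nsq.
  have [p p_pr pD] := not_squarefree_prime (D0 _ i j (or_introl erefl)) nsq.
  have gtZ r : prime r -> disc_sq m r (a i) (b j) -> (Z < r)%N.
    by move=> r_pr dsq; rewrite ltnNge; apply: contraL dsq => /(noZ r r_pr).
  have pZ : (Z < p)%N by apply: gtZ => //; apply/orP; left.
  have qZ : (Z < q)%N by apply: gtZ => //; apply/orP; right.
  apply: (abcB A B (a i) (b j) p q) => //.
  - exact: ltnW.
  - by apply: leq_trans A_le_B; clear - A_ge; lia.
  - by rewrite a2 andbT (leq_trans _ a1) // ltnW.
  - by rewrite b2 andbT (leq_trans _ b1) // ltnW.
  - apply: (@not_disc_sq_coprime m Z) => //.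
    by rewrite (leq_trans a2 AZ) andbT (leq_trans _ a1) // ltnW.
  - by apply: D0; right.
  - exact: Z_lt.
  - exact: Z_lt.
have card_ge : (#|S| <= cardM m.+1 A B)%N.
  by apply: (@card_le_cardM _ _ _ _ S f) => // x y _ _; exact: f_inj.
rewrite -mulrA ler_pdivrMl; last by rewrite ltr0n muln_gt0 expn_gt0 Q_gt0.
rewrite -!natrM ler_nat.
have X2 : (2 <= X)%N by clear - X_ge Q_gt0; lia.
have Y2 : (2 <= Y)%N by exact: leq_trans XY.
apply: leq_trans (leq_mul (leq_progression_size Q_gt0 X2) (leq_progression_size Q_gt0 Y2)) _.
rewrite -/X -/Y.
have -> : (2 * Q * X * (2 * Q * Y) = 4 * Q ^ 2 * (X * Y))%N by rewrite expnS expn1; clear; lia.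
apply: (@leq_trans (4 * Q ^ 2 * (2 * #|S|))%N); first by rewrite leq_mul2l S_half orbT.
apply: (@leq_trans (8 * Q ^ 2 * #|S|)%N); first by clear; lia.
by rewrite leq_mul2l card_ge orbT.
Qed.
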